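(* Let $(\mathcal{M},g)$ be a connected, oriented Riemannian manifold with induced distance $d$, such that $(\mathcal{M},d)$ is a complete separable metric space. Let $X$ be a random element of $\mathcal{M}$ with density $f_X$ with respect to the volume measure $\nu$, such that $(f_X\nu)\otimes(f_X\nu)$-almost every pair $(x,y)\in\mathcal{M}\times\mathcal{M}$ is joined by a unique minimizing geodesic. Let $BD$ be the depth function of $X$ and, for an i.i.d. sample $X_1,\dots,X_n$ distributed as $X$, let $\widehat{BD}_n$ be the empirical depth function. Let $q$ be a fixed point of $\mathcal{M}$. Then (a) $\displaystyle \sup_{p\in\mathcal{M}:\, d(p,q)>M} BD(p)\to 0$ as $M\to+\infty$; (b) $\displaystyle \lim_{M\to\infty}\ \sup_{p\in\mathcal{M}:\, d(p,q)>M}\widehat{BD}_n(p)=0$ almost surely.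
   Context: For points $x,y\in\mathcal{M}$ joined by a unique minimizing geodesic, $\frac{xy}{2}$ denotes the midpoint of that geodesic, and $B_{xy}$ denotes the closed geodesic ball with center $\frac{xy}{2}$ and radius $d(x,y)/2$. By assumption this is defined almost surely for pairs of independent copies of $X$. Depth: for $p\in\mathcal{M}$, $BD(p):=P(p\in B_{X_1X_2})$, where $X_1,X_2$ are independent with the same distribution as $X$. Empirical depth: for an i.i.d. sample $X_1,\dots,X_n$ ($n\ge 2$) distributed as $X$, $\widehat{BD}_n(p):=\binom{n}{2}^{-1}\sum_{1\le i_1<i_2\le n}\mathbf{1}_{B_{X_{i_1}X_{i_2}}}(p)$. *)

(* Defs.v *)
From HB Require Import structures.
From mathcomp Require Import all_boot all_order all_algebra.
From mathcomp Require Import all_classical all_reals all_analysis.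

Set Implicit Arguments.
Unset Strict Implicit.
Unset Printing Implicit Defensive.

Import Order.TTheory GRing.Theory Num.Theory.
Import numFieldNormedType.Exports.

Local Open Scope classical_set_scope.
Local Open Scope ring_scope.

(* Pointedness is only there because the library puts sigma-algebras on
   pointed types. *)
#[short(type="pmetricType")]
HB.structure Definition PointedMetric (K : numDomainType) :=
  { M of Metric K M & Pointed M }.

Notation borel M := (g_sigma_algebraType (@open M)).

Definition complete_space (T : uniformType) :=
  forall F : set_system T, ProperFilter F -> cauchy F ->
    exists x : T, F --> x.

Definition separable_space (T : topologicalType) :=
  exists2 D : set T, countable D & dense D.

Section smooth_maps.
Context (R : realType) (m : nat).
Implicit Types (U : set 'rV[R]_m) (f : 'rV[R]_m -> R).

Definition partial (i : 'I_m) f : 'rV[R]_m -> R := 'D_(delta_mx 0 i) f.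

(* U is meant to be open. *)
Fixpoint Ck_on (k : nat) U f : Prop :=
  (forall u, U u -> {for u, continuous f}) /\
  if k is k'.+1 then
    forall i : 'I_m, (forall u, U u -> derivable f u (delta_mx 0 i)) /\
                     Ck_on k' U (partial i f)
  else True.

Definition smooth_on U f := forall k, Ck_on k U f.

End smooth_maps.

Record chart (R : realType) (m : nat) (M : topologicalType) := Chart {
  chart_dom : set M ;
  chart_map :> M -> 'rV[R]_m ;
  chart_inv : 'rV[R]_m -> M ;
  chart_dom_open : open chart_dom ;
  chart_cod_open : open (chart_map @` chart_dom) ;
  chart_mapK : forall x, chart_dom x -> chart_inv (chart_map x) = x ;
  chart_map_continuous : forall x, chart_dom x ->
    {for x, continuous chart_map} ;
  chart_inv_continuous : forall u, (chart_map @` chart_dom) u ->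
    {for u, continuous chart_inv}
}.

Section chart_ops.
Context (R : realType) (m : nat) (M : topologicalType).
Implicit Types phi psi : chart R m M.

Definition chart_cod phi : set 'rV[R]_m := phi @` chart_dom phi.

Definition overlap phi psi : set 'rV[R]_m :=
  phi @` (chart_dom phi `&` chart_dom psi).

Definition transition phi psi : 'rV[R]_m -> 'rV[R]_m :=
  fun u => psi (chart_inv phi u).

End chart_ops.

(* An oriented smooth atlas with a Riemannian metric, given by its Gram matrices
   [gram phi u] in the coordinates of each chart.  The differential at u of a
   map f is v |-> v *m jacobian f u on row vectors, whence the side on which the
   transpose appears in gram_transition. *)
Record orientedRiemannian (R : realType) (m : nat) (M : topologicalType) :=
  OrientedRiemannian {
  atlas : set (chart R m M) ;
  chart_at : M -> chart R m M ;
  chart_at_atlas : forall x, atlas (chart_at x) ;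
  mem_chart_at : forall x, chart_dom (chart_at x) x ;
  transition_smooth : forall phi psi, atlas phi -> atlas psi ->
    forall k : 'I_m,
      smooth_on (overlap phi psi) (fun u => transition phi psi u 0 k) ;
  transition_oriented : forall phi psi, atlas phi -> atlas psi ->
    forall u, overlap phi psi u -> 0 < \det (jacobian (transition phi psi) u) ;
  gram : chart R m M -> 'rV[R]_m -> 'M[R]_m ;
  gram_smooth : forall phi, atlas phi -> forall k l : 'I_m,
    smooth_on (chart_cod phi) (fun u => gram phi u k l) ;
  gram_sym : forall phi u, atlas phi -> chart_cod phi u ->
    (gram phi u)^T = gram phi u ;
  gram_posdef : forall phi u, atlas phi -> chart_cod phi u ->
    forall v : 'rV[R]_m, v != 0 -> 0 < (v *m gram phi u *m v^T) 0 0 ;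
  gram_transition : forall phi psi u, atlas phi -> atlas psi ->
    overlap phi psi u ->
    let J := jacobian (transition phi psi) u in
    gram phi u = J *m gram psi (transition phi psi u) *m J^T
}.

Section riemannian_geometry.
Context (R : realType) (m : nat) (M : topologicalType).
Variable g : orientedRiemannian R m M.
Implicit Types (c : R -> M) (x y : M).

(* c read in the chart at c t *)
Definition local_curve c (t : R) : R -> 'rV[R]_m :=
  fun s => chart_at g (c t) (c s).

Definition speed c (t : R) : R :=
  let v := derive1 (local_curve c t) t in
  Num.sqrt ((v *m gram g (chart_at g (c t)) (local_curve c t t) *m v^T) 0 0).

Definition curve_length c (a b : R) : \bar R :=
  (\int[lebesgue_measure]_(t in `[a, b]) (speed c t)%:E)%E.

Definition C1_at c (t : R) : Prop :=
  [/\ {for t, continuous c},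
      \forall s \near t, derivable (local_curve c t) s 1 &
      {for t, continuous (derive1 (local_curve c t))}].

(* C1 up to the end points, i.e. the restriction to [a, b] of a curve that is
   C1 around each point of [a, b]. *)
Definition C1_segment c (a b : R) : Prop :=
  exists c' : R -> M, forall t, a <= t <= b -> C1_at c' t /\ c' t = c t.

(* s lists the break points after a, ending with b. *)
Definition piecewise_C1 c (a b : R) : Prop :=
  exists s : seq R, [/\ path <%R a s, last a s = b &
    forall i, (i < size s)%N -> C1_segment c (nth a (a :: s) i) (nth a s i)].

Definition riemannian_dist x y : \bar R :=
  ereal_inf [set L | exists (c : R -> M) (a b : R),
    [/\ piecewise_C1 c a b, c a = x, c b = y & L = curve_length c a b]].

Definition christoffel (phi : chart R m M) (k i j : 'I_m) (u : 'rV[R]_m) : R :=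
  2^-1 * \sum_(l < m) invmx (gram g phi u) k l *
    (partial i (fun w => gram g phi w j l) u +
     partial j (fun w => gram g phi w i l) u -
     partial l (fun w => gram g phi w i j) u).

Definition geodesic_at c (t : R) : Prop :=
  let gamma := local_curve c t in
  [/\ {for t, continuous c},
      \forall s \near t, derivable gamma s 1,
      \forall s \near t, derivable (derive1 gamma) s 1 &
      forall k : 'I_m,
        derive1 (derive1 gamma) t 0 k +
        \sum_(i < m) \sum_(j < m)
          christoffel (chart_at g (c t)) k i j (gamma t) *
          derive1 gamma t 0 i * derive1 gamma t 0 j = 0].

Definition minimizing_geodesic x y c : Prop :=
  [/\ c 0 = x, c 1 = y, (forall t, 0 <= t <= 1 -> geodesic_at c t) &
      curve_length c 0 1 = riemannian_dist x y].

(* Only the restriction of c to [0, 1] is meaningful. *)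
Definition unique_minimizing_geodesic x y : Prop :=
  exists2 c, minimizing_geodesic x y c &
    forall c', minimizing_geodesic x y c' ->
      forall t, 0 <= t <= 1 -> c' t = c t.

(* The point halfway along, by arc length, a minimizing geodesic from x to y.
   Relevant only where unique_minimizing_geodesic x y holds. *)
Definition midpoint x y : M :=
  xget x [set z | exists (c : R -> M) (t : R),
    [/\ minimizing_geodesic x y c, 0 <= t <= 1, z = c t &
        curve_length c 0 t = ((2^-1)%:E * curve_length c 0 1)%E]].

End riemannian_geometry.

Section volume.
Context (R : realType) (m : nat) (M : pmetricType R).

Definition is_lebesgue (lambda : {measure set (borel 'rV[R]_m) -> \bar R}) :=
  forall a b : 'rV[R]_m, (forall i, a 0 i <= b 0 i) ->
    lambda [set v : 'rV[R]_m | forall i, a 0 i <= v 0 i <= b 0 i] =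
    (\prod_(i < m) (b 0 i - a 0 i))%:E.

(* Determines nu, as countably many chart domains cover a separable M. *)
Definition is_volume (g : orientedRiemannian R m M)
    (nu : {measure set (borel M) -> \bar R}) :=
  exists2 lambda : {measure set (borel 'rV[R]_m) -> \bar R},
    is_lebesgue lambda &
    forall (phi : chart R m M) (A : set (borel M)), atlas g phi ->
      measurable A -> A `<=` chart_dom phi ->
      nu A =
        (\int[lambda]_(u in phi @` A) (Num.sqrt (\det (gram g phi u)))%:E)%E.

End volume.

Section depth.
Context (R : realType) (m : nat) (M : pmetricType R).
Variable g : orientedRiemannian R m M.

Definition geoball (x y : M) : set M :=
  [set p | mdist (midpoint g x y) p <= mdist x y / 2].

Context (d : measure_display) (Omega : measurableType d)
  (P : probability Omega R).

(* Since geoball x y is meaningful only up to a null set of pairs (x, y), the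
   event need only be measurable for the completion of P; the latter is given
   by the outer measure mu_ext P, which equals P on measurable sets. *)
Definition depth (X1 X2 : Omega -> M) (p : M) : R :=
  fine (mu_ext P [set w | geoball (X1 w) (X2 w) p]).

Definition empirical_depth (n : nat) (X : 'I_n -> Omega -> M) (w : Omega)
    (p : M) : R :=
  ('C(n, 2)%:R)^-1 *
  \sum_(i < n) \sum_(j < n | (i < j)%N) \1_(geoball (X i w) (X j w)) p.

Definition has_density (nu : {measure set (borel M) -> \bar R})
    (X : {mfun Omega >-> borel M}) (f : borel M -> R) :=
  [/\ measurable_fun setT f, (forall x, 0 <= f x) &
      forall A, measurable A ->
        distribution P X A = (\int[nu]_(x in A) (f x)%:E)%E].

Definition iid_copies (n : nat) (X : {mfun Omega >-> borel M})
    (Xs : 'I_n -> {mfun Omega >-> borel M}) :=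
  (forall i A, measurable A -> distribution P (Xs i) A = distribution P X A) /\
  (forall A : 'I_n -> set (borel M), (forall i, measurable (A i)) ->
    P (\bigcap_i (Xs i @^-1` A i)) = (\prod_(i < n) P (Xs i @^-1` A i))%E).

End depth.

(* The supremum of a [0, 1]-valued F, with sup of the empty set equal to 0
   (which occurs for bounded M). *)
Definition sup_beyond (R : realType) (M : pmetricType R) (F : M -> R) (q : M)
    (r : R) : R :=
  sup [set F p | p in [set p | mdist p q > r]].

(* Main.v *)
(** The midpoint z of x and y lies on a minimizing geodesic, at length d(x, y)/2
    from x, so d(x, z) <= d(x, y)/2; hence every p in B_xy satisfies
    d(p, q) <= d(p, z) + d(z, x) + d(x, q) <= 2 d(x, q) + d(y, q).  Thus p in
    B_xy with d(p, q) > 3K forces x or y out of the closed K-ball around q.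
    For (a), this event does not depend on p and its probability tends to 0 as K
    grows; for (b), finitely many sample points lie in one ball around q, and
    the empirical depth vanishes far away. *)
Require Import Defs.
From HB Require Import structures.
From mathcomp Require Import all_boot all_order all_algebra.
From mathcomp Require Import all_classical all_reals all_analysis.
From mathcomp Require Import lra.

Set Implicit Arguments.
Unset Strict Implicit.
Unset Printing Implicit Defensive.

Import Order.TTheory GRing.Theory Num.Theory.
Import numFieldNormedType.Exports.

Local Open Scope classical_set_scope.
Local Open Scope ring_scope.

Section tail_suprema.
Context (R : realType) (M : pmetricType R).
Implicit Types (F : M -> R) (p q : M).

(** Reduces both limits to a bound that is uniform in [p] far from [q]: beyond [K], [e] bounds all
    the values and hence their supremum. *)
Lemma sup_beyond_cvg0 F q : (forall p, 0 <= F p) ->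
  (forall e, 0 < e -> exists K, forall p, K < mdist p q -> F p <= e) ->
  sup_beyond F q r @[r --> +oo] --> 0.
Proof.
move=> F0 small; apply/cvgr0Pnorm_le => e e0.
have [K FK] := small e e0.
exists K; split; first exact: num_real.
move=> r Kr; rewrite /sup_beyond; set S := (X in sup X).
(* If no point lies beyond [r], the supremum is 0 by convention. *)
have [->|/set0P S0] := eqVneq S set0; first by rewrite sup0 normr0 ltW.
have Se : ubound S e by move=> _ [p /= rp <-]; apply/FK/(lt_trans Kr).
have [x Sx] := S0; have x0 : 0 <= x by case: Sx => p _ <-.
rewrite ger0_norm; first exact: ge_sup.
by apply: le_trans x0 (ub_le_sup _ Sx); exists e.
Qed.

Lemma open_mdist_gt q (r : R) : open [set x : M | r < mdist x q].
Proof.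
rewrite openE => x /= rx; apply/nbhs_ballP; exists (mdist x q - r).
  by rewrite /= subr_gt0.
move=> y /=; rewrite ballEmdist/= => xy.
by have := metric_triangle x y q; lra.
Qed.

End tail_suprema.

Section geodesic_balls.
Context (R : realType) (m : nat).

(** The velocity is differentiable at [t], hence continuous there. *)
Lemma geodesic_at_C1 (M : topologicalType) (g : orientedRiemannian R m M)
  (c : R -> M) (t : R) : geodesic_at g c t -> C1_at g c t.
Proof.
case=> cc d1 d2 _; split => //.
by apply/differentiable_continuous/derivable1_diffP/(nbhs_singleton d2).
Qed.

(** The curve competes in the infimum, with [b] as its only break point; break points increase
    strictly, whence [a < b]. *)
Lemma C1_riemannian_dist_le (M : topologicalType) (g : orientedRiemannian R m M)
    (c : R -> M) (a b : R) : a < b ->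
    (forall t, a <= t <= b -> C1_at g c t) ->
  (riemannian_dist g (c a) (c b) <= curve_length g c a b)%E.
Proof.
move=> ab cC1; apply: ereal_inf_lbound; exists c, a, b; split => //.
exists [:: b]; split => //=; first by rewrite ab.
by case=> // _; exists c => t tab; split => //; exact: cC1.
Qed.

Context (M : pmetricType R) (g : orientedRiemannian R m M).
Hypothesis g_dist : forall x y : M, (mdist x y)%:E = riemannian_dist g x y.

Lemma mdist_midpoint_le (x y : M) : mdist x (midpoint g x y) <= mdist x y / 2.
Proof.
(* When there is no candidate midpoint, [xget] returns its default [x]. *)
rewrite /midpoint; case: xgetP => [z _ /=|_]; last first.
  by rewrite mdistxx divr_ge0 ?mdist_ge0.
move=> [c [t [[c0 _ geo len] /andP[t0 t1] -> half]]].
(* At [t = 0] the midpoint is [x]; otherwise the arc of [c] over [[0, t]] has half the length of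
   [c], that is [mdist x y / 2]. *)
move: t0; rewrite le_eqVlt => /predU1P[<-|t0].
  by rewrite c0 mdistxx divr_ge0 ?mdist_ge0.
rewrite -lee_fin g_dist -[x in riemannian_dist _ x _]c0.
apply: (le_trans (C1_riemannian_dist_le t0 _)) => [s /andP[s0 st]|].
  by apply/geodesic_at_C1/geo; rewrite s0 (le_trans st).
by rewrite half len -g_dist -EFinM mulrC.
Qed.

Lemma geoball_mdist_le (x y p q : M) : geoball g x y p ->
  mdist p q <= 2 * mdist x q + mdist y q.
Proof.
rewrite /geoball/= => bp; have := mdist_midpoint_le x y.
have := metric_triangle p (midpoint g x y) q.
have := metric_triangle (midpoint g x y) x q.
have := metric_triangle x q y.
rewrite (metric_sym p (midpoint g x y)) (metric_sym (midpoint g x y) x).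
by rewrite (metric_sym q y); lra.
Qed.

(** The factor 3 is the sum of the coefficients 2 and 1 in [geoball_mdist_le]. *)
Lemma geoball_far (x y p q : M) (K : R) : geoball g x y p ->
  3 * K < mdist p q -> K < mdist x q \/ K < mdist y q.
Proof.
move=> /(geoball_mdist_le q) bp pK.
by case: (ltP K (mdist x q)) => [|xK]; [left|right; lra].
Qed.

End geodesic_balls.

Section depth_decay.
Context (R : realType) (m : nat) (M : pmetricType R).
Variable g : orientedRiemannian R m M.
Hypothesis g_dist : forall x y : M, (mdist x y)%:E = riemannian_dist g x y.
Context (d : measure_display) (Omega : measurableType d)
  (P : probability Omega R).

Lemma measurable_mfun_far (X : {mfun Omega >-> borel M}) (q : M) (r : R) :
  measurable (X @^-1` [set x : M | r < mdist x q]).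
Proof.
apply: (measurable_funPTI X); apply: sub_sigma_algebra; exact: open_mdist_gt.
Qed.

(** Continuity from above: the events decrease to the empty set, since every distance to [q] is
    finite. *)
Lemma mfun_far_cvg0 (X : {mfun Omega >-> borel M}) (q : M) :
  P (X @^-1` [set x : M | k%:R < mdist x q]) @[k --> \oo] --> 0%E.
Proof.
pose A k := X @^-1` [set x : M | k%:R < mdist x q].
have mA k : measurable (A k) by exact: measurable_mfun_far.
have A0 : \bigcap_k A k = set0.
  apply/seteqP; split=> // w /(_ (Num.truncn (mdist (X w : M) q)).+1 I).
  by rewrite /A/= ltNge (ltW (truncnS_gt _)).
have := @nonincreasing_cvg_mu _ _ _ P A.
rewrite A0 measure0; apply => //.
- by rewrite (le_lt_trans (probability_le1 _ _)) ?ltry.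
- move=> k l kl; apply/subsetPset => w; rewrite /A/=; apply: le_lt_trans.
  by rewrite ler_nat.
Qed.

Lemma depth_ge0 (X1 X2 : Omega -> M) (p : M) : 0 <= depth g P X1 X2 p.
Proof. by rewrite fine_ge0 ?mu_ext_ge0. Qed.

Lemma depth_sup_beyond_cvg0 (X1 X2 : {mfun Omega >-> borel M}) (q : M) :
  sup_beyond (depth g P X1 X2) q r @[r --> +oo] --> 0.
Proof.
apply: sup_beyond_cvg0 => [p|e e0]; first exact: depth_ge0.
pose A (X : Omega -> M) k := X @^-1` [set x : M | k%:R < mdist x q].
have mA (X : {mfun Omega >-> borel M}) k : measurable (A X k).
  exact: measurable_mfun_far.
have : (P (A X1 k) + P (A X2 k))%E @[k --> \oo] --> 0%E.
  by rewrite -[0%E]adde0; apply: cvgeD => //; exact: mfun_far_cvg0.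
move=> /fine_cvgP[_ /cvgr0Pnorm_le/(_ e e0)[k _ /(_ k (leqnn k))/=]] Pe.
exists (3 * k%:R) => p pk.
have PAfin : (P (A X1 k) + P (A X2 k))%E \is a fin_num.
  by rewrite fin_numD !fin_num_measure.
(* The ball event lies in [A X1 k] or [A X2 k], which are measurable and do not involve [p];
   monotonicity of the outer measure and the union bound conclude. *)
have le : (mu_ext P [set w | geoball g (X1 w) (X2 w) p] <=
    P (A X1 k) + P (A X2 k))%E.
  apply: (@le_trans _ _ (P (A X1 k `|` A X2 k))); last first.
    by apply: measureU2; exact: mA.
  rewrite -(measurable_mu_extE P); last by apply: measurableU; exact: mA.
  by apply: le_mu_ext => w /= bp; exact: (geoball_far g_dist bp pk).
apply: (le_trans _ (le_trans (ler_norm _) Pe)).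
(* [fine] is monotone only between finite values. *)
apply: fine_le => //; rewrite ge0_fin_numE ?mu_ext_ge0//.
by apply: le_lt_trans le _; rewrite ltey_eq PAfin.
Qed.

Lemma empirical_depth_sup_beyond_cvg0 n (X : 'I_n -> Omega -> M) (w : Omega)
  (q : M) : sup_beyond (empirical_depth g X w) q r @[r --> +oo] --> 0.
Proof.
apply: sup_beyond_cvg0 => [p|e e0].
  by rewrite mulr_ge0 ?invr_ge0// sumr_ge0// => i _; rewrite sumr_ge0.
(* For a fixed outcome [w], this sum dominates each distance, so the [K]-ball around [q] contains
   the whole sample and every indicator vanishes beyond [3 * K]. *)
pose K := \sum_(i < n) mdist (X i w) q.
have XK i : mdist (X i w) q <= K.
  by rewrite /K (bigD1 i)//= lerDl sumr_ge0// => j _; exact: mdist_ge0.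
exists (3 * K) => p pK.
rewrite /empirical_depth big1 ?mulr0 ?ltW// => i _; rewrite big1// => j _.
rewrite indicE memNset// => /(geoball_far g_dist)/(_ pK)[].
  by rewrite ltNge XK.
by rewrite ltNge XK.
Qed.

End depth_decay.

Theorem theorem3p1 (R : realType) (m : nat) (M : pmetricType R)
    (g : orientedRiemannian R m M)
    (g_dist : forall x y : M, (mdist x y)%:E = riemannian_dist g x y)
    (M_connected : connected [set: M])
    (M_complete : complete_space M)
    (M_separable : separable_space M)
    (nu : {measure set (borel M) -> \bar R})
    (nu_volume : is_volume g nu)
    (d : measure_display) (Omega : measurableType d) (P : probability Omega R)
    (X : {mfun Omega >-> borel M}) (fX : borel M -> R)
    (X_density : has_density P nu X fX)
    (X_geodesic : {ae (distribution P X \x distribution P X)%E,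
       forall xy : borel M * borel M, unique_minimizing_geodesic g xy.1 xy.2})
    (q : M) :
  (forall Xs : 'I_2 -> {mfun Omega >-> borel M}, iid_copies P X Xs ->
    sup_beyond (depth g P (Xs ord0) (Xs ord_max)) q r @[r --> +oo] --> 0) /\
  (forall (n : nat) (Xs : 'I_n -> {mfun Omega >-> borel M}), (2 <= n)%N ->
    iid_copies P X Xs ->
    {ae P, forall w : Omega,
      sup_beyond (empirical_depth g (fun i => Xs i) w) q r
        @[r --> +oo] --> 0}).
Proof.
split=> [Xs _|n Xs _ _]; first exact: depth_sup_beyond_cvg0.
by apply: aeW => w; exact: empirical_depth_sup_beyond_cvg0.
Qed.
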